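(* Let $T$ be a bounded linear operator on a complex separable Hilbert space $\mathcal H$ with the wandering subspace property. Then $T$ is circular if and only if for each $\lambda\in\mathbb T$ there exists a unitary $V_\lambda$ on $\ker T^*$ such that the map $U_\lambda:\operatorname{span}\{T^n(\ker T^* ):n\in\mathbb N\}\to\mathcal H$ defined by $$U_\lambda\Big(\sum_{j=0}^n T^jx_j\Big)=\sum_{j=0}^n(\lambda T)^jV_\lambda x_j,\qquad x_j\in\ker T^*,\ n\in\mathbb N,$$ extends to a unitary on $\mathcal H$ (in particular, this includes that $U_\lambda$ is well defined).
   Context: $\mathbb N$ denotes the set of non-negative integers and $\mathbb T=\{\lambda\in\mathbb C:|\lambda|=1\}$. A bounded linear operator $T$ on a complex Hilbert space $\mathcal H$ is circular if for each $\lambda\in\mathbb T$ there exists a unitary operator $U_\lambda$ on $\mathcal H$ such that $U_\lambda T=\lambda TU_\lambda$. $T$ has the wandering subspace property if $\mathcal H=\bigvee_{n\in\mathbb N}T^n(\ker T^* )$, where $\bigvee$ denotes the closed linear span. *)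

(* Defs.v *)
From HB Require Import structures.
From mathcomp Require Export all_boot all_order all_algebra.
From mathcomp Require Export complex.
From mathcomp Require Export all_classical all_reals all_analysis.
Export numFieldNormedType.Exports.
Set Implicit Arguments.
Unset Strict Implicit.
Unset Printing Implicit Defensive.
Import Order.TTheory GRing.Theory Num.Theory.
Local Open Scope classical_set_scope.
Local Open Scope ring_scope.
Local Open Scope complex_scope.

Definition separable (X : topologicalType) : Prop :=
  exists2 S : set X, countable S & dense S.

Section HilbertSpace.
Variables (R : realType) (H : completeNormedModType R[i]).

Definition lin_span (A : set H) : set H :=
  [set h | exists n (a : 'I_n -> R[i]) (v : 'I_n -> H),
    (forall i, A (v i)) /\ h = \sum_(i < n) a i *: v i].

(* Together with completeness of H, this makes H a Hilbert space with inner
   product [dot], linear in its first argument. *)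
Definition norm_from_dot (dot : {dot H for Num.conj}) : Prop :=
  forall x : H, `|x| ^+ 2 = dot x x.

Variable dot : {dot H for Num.conj}.

(* For a bounded linear T on a Hilbert space, the set of admissible z is a
   singleton by the Riesz representation theorem, so the default value 0 of
   [xget] is never used. *)
Definition adjoint (T : H -> H) (y : H) : H :=
  xget 0 [set z | forall x, dot (T x) y = dot x z].

Definition ker_adjoint (T : H -> H) : set H := [set y | adjoint T y = 0].

(* V is a unitary operator of the Hilbert space K, a closed linear subspace
   of H; the values of V outside K are irrelevant. *)
Definition unitary_on (K : set H) (V : H -> H) : Prop :=
  [/\ forall (a : R[i]) x y, K x -> K y -> V (a *: x + y) = a *: V x + V y,
      forall x y, K x -> K y -> dot (V x) (V y) = dot x y
    & V @` K = K].

Definition unitary (U : H -> H) : Prop := unitary_on setT U.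

Definition circular (T : H -> H) : Prop :=
  forall lam : R[i], `|lam| = 1 ->
    exists2 U, unitary U & forall h, U (T h) = lam *: T (U h).

Definition wandering_span (T : H -> H) : set H :=
  lin_span (\bigcup_n (iter n T @` ker_adjoint T)).

Definition wandering_subspace_property (T : H -> H) : Prop :=
  closure (wandering_span T) = setT.

(* U satisfies the defining formula on the wandering span, on which it is
   thereby determined; the existence of such a U says that the formula gives
   a well-defined map there. *)
Definition circular_formula (T V : H -> H) (lam : R[i]) (U : H -> H) : Prop :=
  forall n (x : 'I_n.+1 -> H), (forall j, ker_adjoint T (x j)) ->
    U (\sum_(j < n.+1) iter j T (x j)) =
    \sum_(j < n.+1) iter j (fun h => lam *: T h) (V (x j)).

End HilbertSpace.

(* Main.v *)
(* If U T = lam T U with U unitary, then T^* U = lam U T^*, so U restricts to a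
   unitary V of ker T^*, and U itself extends the map given by the formula.
   Conversely, the formula gives W T h = lam T W h first for h = T^n y with
   y in ker T^*, then on the span by linearity, and everywhere by density and
   continuity. *)
From HB Require Import structures.
Require Import Defs.
Import Order.TTheory GRing.Theory Num.Theory.
Local Open Scope classical_set_scope.
Local Open Scope ring_scope.
Local Open Scope complex_scope.

Section Adjoint.
Set Implicit Arguments.
Unset Strict Implicit.
Variables (R : realType) (H : completeNormedModType R[i]).
Variables (dot : {dot H for Num.conj}) (dot_norm : norm_from_dot dot).

Lemma norm_from_dot_eq0 x : dot x x = 0 -> x = 0.
Proof. by rewrite -dot_norm => /eqP; rewrite expf_eq0 /= normr_eq0 => /eqP. Qed.

Lemma adjoint_eq (T : H -> H) y z :
  (forall x, dot (T x) y = dot x z) -> adjoint dot T y = z.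
Proof.
move=> yz; apply: xget_unique => // w yw.
apply/eqP; rewrite -subr_eq0; apply/eqP.
(* Two representing vectors [w] and [z] pair equally with every vector, in particular with [w - z],
   so [w - z] is orthogonal to itself. *)
apply: norm_from_dot_eq0; rewrite linearBr; apply/eqP; rewrite subr_eq0.
by apply/eqP; exact: etrans (esym (yw _)) (yz _).
Qed.

Lemma adjoint0 (T : H -> H) : adjoint dot T 0 = 0.
Proof. by apply: adjoint_eq => x; rewrite !linear0r. Qed.

Lemma unitary_is_linear U : unitary dot U -> exists f : {linear H -> H}, U = f.
Proof.
move=> [Ulin _ _].
have Ul : linear U by move=> a x y; exact: Ulin.
pose f : {linear H -> H} :=
  HB.pack U (GRing.isLinear.Build R[i] H H *:%R U Ul).
by exists f.
Qed.

Lemma unitary_norm U x : unitary dot U -> `|U x| = `|x|.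
Proof.
move=> [_ Udot _]; apply/eqP.
by rewrite -(eqrXn2 (n := 2)) // !dot_norm Udot.
Qed.

Lemma unitary_surj U y : unitary dot U -> exists x, U x = y.
Proof.
move=> [_ _ UT]; have : setT y by [].
by rewrite -UT => -[x _ <-]; exists x.
Qed.

Lemma unitary_continuous U : unitary dot U -> continuous U.
Proof.
move=> Uu; have Un x := unitary_norm x Uu.
have [f Uf] := unitary_is_linear Uu; rewrite Uf.
apply/linear_bounded_continuous.
apply/linear_boundedP.
apply: filterS _ (nbhs_pinfty_ge (@real1 _)) => r r1 x.
by rewrite -Uf Un ler_peMl.
Qed.

(* The existence part of the Riesz theorem is avoided: at points where
   [adjoint] might take its default value 0, both sides default together. *)
Lemma adjoint_unitary (T : {linear H -> H}) (lam : R[i]) U y :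
  `|lam| = 1 -> unitary dot U -> (forall h, U (T h) = lam *: T (U h)) ->
  adjoint dot T (U y) = lam *: U (adjoint dot T y).
Proof.
move=> lam1 Uu UT; have [f Uf] := unitary_is_linear Uu.
have Udot a b : dot (U a) (U b) = dot a b by case: Uu => _ ->.
have lam0 : lam != 0 by rewrite -normr_eq0 lam1 oner_eq0.
(* Commuting [T] past [U] costs a factor [lam^-1]; pulling [lam] out of the conjugate-linear second
   argument gives [lam^*]. On the unit circle the two agree. *)
have lamV : lam^-1 = lam^* by rewrite invC_norm lam1 expr1n invr1 mul1r.
have [[z yz]|nz] := pselect (exists z, forall x, dot (T x) y = dot x z).
  rewrite (adjoint_eq yz); apply: adjoint_eq => x'.
  have [x <-] := unitary_surj x' Uu.
  have -> : T (U x) = lam^-1 *: U (T x) by rewrite UT scalerA mulVf ?scale1r.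
  by rewrite linearZl_LR linearZr_LR /= !Udot yz lamV.
rewrite /adjoint !xgetPN; first by rewrite Uf linear0 scaler0.
  by move=> z yz; apply: nz; exists z.
move=> w' yw; have [w Uw] := unitary_surj w' Uu.
(* If [U w] represents the functional for [U y], then [dot (T x) y] equals [lam * dot x w], and
   [lam] enters the second argument as [lam^*]. *)
apply: nz; exists (lam^* *: w) => x.
by rewrite linearZr_LR /= conjCK -Udot UT linearZl_LR /= yw -Uw Udot.
Qed.

Lemma ker_adjoint_unitary (T : {linear H -> H}) (lam : R[i]) U :
  `|lam| = 1 -> unitary dot U -> (forall h, U (T h) = lam *: T (U h)) ->
  U @` ker_adjoint dot T = ker_adjoint dot T.
Proof.
move=> lam1 Uu UT; have lam0 : lam != 0 by rewrite -normr_eq0 lam1 oner_eq0.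
have [f Uf] := unitary_is_linear Uu.
apply/seteqP; split => [_ [y yk <-]|y' yk].
  by rewrite /ker_adjoint /= (adjoint_unitary _ lam1) // yk Uf linear0 scaler0.
have [y Uy] := unitary_surj y' Uu; exists y => //.
(* The kernel condition on [U y] says that [lam] times the [U]-image of the adjoint at [y] is 0;
   [lam] is nonzero and [U] preserves norms, so both cancel. *)
move: yk; rewrite /ker_adjoint /= -Uy (adjoint_unitary _ lam1) // => /eqP.
by rewrite scaler_eq0 (negPf lam0) -normr_eq0 unitary_norm // normr_eq0 => /eqP.
Qed.

End Adjoint.

(** The equalizer is the preimage of the closed set [[set 0]] under the continuous map [f - g]. *)
Lemma closure_eq_continuous (X : topologicalType) (K : numFieldType)
    (V : normedModType K) (f g : X -> V) (A : set X) :
  continuous f -> continuous g -> (forall x, A x -> f x = g x) ->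
  forall x, closure A x -> f x = g x.
Proof.
move=> cf cg fg.
have clE : closed [set x | f x - g x = 0].
  apply: (@preimage_closed _ _ (fun x => f x - g x) [set 0]).
    by move=> x _; apply: cvgB; [exact: cf|exact: cg].
  exact/accessible_closed_set1/hausdorff_accessible/norm_hausdorff.
move=> x Ax; apply/eqP; rewrite -subr_eq0; apply/eqP.
apply: clE; apply: closureS Ax => y Ay /=.
by rewrite fg // subrr.
Qed.

(** The circular formula only concerns whole sums over [j <= n]; padding with zeros lets it speak
    about a single power [T^n y]. *)
Lemma sum_ord_last (V W : nmodType) (F : nat -> V -> W) n (y : V) :
  (forall j, F j 0 = 0) ->
  \sum_(j < n.+1) F j (if j == n :> nat then y else 0) = F n y.
Proof.
move=> F0; rewrite big_ord_recr /= eqxx big1 ?add0r // => j _.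
by rewrite (ltn_eqF (ltn_ord j)) F0.
Qed.

Theorem proposition2p1 (R : realType) (H : completeNormedModType R[i])
    (dot : {dot H for Num.conj}) (dot_norm : norm_from_dot dot)
    (H_separable : separable H)
    (T : {linear H -> H}) (T_bounded : bounded_near T (nbhs (0 : H)))
    (T_wandering : wandering_subspace_property dot T) :
  circular dot T <->
  (forall lam : R[i], `|lam| = 1 ->
     exists2 V : H -> H, unitary_on dot (ker_adjoint dot T) V &
     exists2 U : H -> H, circular_formula dot T V lam U &
     exists2 W : H -> H, unitary dot W &
       forall h, wandering_span dot T h -> W h = U h).
Proof.
split=> [Tcirc lam lam1|Tform lam lam1].
  have [U Uu UT] := Tcirc lam lam1; have [f Uf] := unitary_is_linear Uu.
  exists U.
    split; [by move=> *; rewrite Uf linearP| by case: Uu => _ + _ *; apply|].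
    exact: (ker_adjoint_unitary dot_norm lam1).
  exists U; last by exists U.
  have Uiter j h : U (iter j T h) = iter j (fun h => lam *: T h) (U h).
    by elim: j => //= j IHj; rewrite UT IHj.
  move=> n x _; rewrite [in LHS]Uf linear_sum /=.
  by apply: eq_bigr => j _; rewrite -Uf Uiter.
have [V [Vlin _ _] [U UV [W Wu WU]]] := Tform lam lam1.
exists W => // h; have [f Wf] := unitary_is_linear Wu.
have K0 : ker_adjoint dot T 0 by exact: adjoint0.
(* [V] is linear only on the kernel, so its value at 0 comes from additivity at the kernel vector 0.
   The padding terms vanish because of it. *)
have V0 : V 0 = 0.
  apply: (addrI (V 0)).
  by rewrite addr0 -{1}[V 0]scale1r -Vlin // scaler0 addr0.
have spanT n y : ker_adjoint dot T y -> wandering_span dot T (iter n T y).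
  move=> yk; exists 1%N, (fun=> 1), (fun=> iter n T y).
  by rewrite big_ord1 scale1r; split=> // _; exists n => //; exists y.
have Wpow n y : ker_adjoint dot T y ->
    W (iter n T y) = iter n (fun h => lam *: T h) (V y).
  move=> yk; rewrite WU; last exact: spanT.
  have iter0 (g : H -> H) j : g 0 = 0 -> iter j g 0 = 0.
    by move=> g0; elim: j => //= j ->.
  have xK (j : 'I_n.+1) : ker_adjoint dot T (if j == n :> nat then y else 0).
    by case: ifP.
  (* Both sides become sums over the same zero-padded family, which turns the goal into an instance
     of the formula. *)
  have Tsum := @sum_ord_last H H (fun j => iter j T) n y.
  rewrite -Tsum => [|j]; last by rewrite iter0 ?linear0.
  have Vsum := @sum_ord_last H H
    (fun j z => iter j (fun h => lam *: T h) (V z)) n y.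
  rewrite -Vsum => [|j]; last by rewrite V0 iter0 ?linear0 ?scaler0.
  exact: UV xK.
have Tcont : continuous T by apply/linear_bounded_continuous.
have Wcont := unitary_continuous dot_norm Wu.
apply: (@closure_eq_continuous H _ H (W \o T) (fun h => lam *: T (W h))
  (wandering_span dot T)); last by rewrite T_wandering.
- by move=> x; apply: continuous_comp; [exact: Tcont|exact: Wcont].
- move=> x; apply: cvgZr; apply: continuous_comp; [exact: Wcont|exact: Tcont].
move=> _ [n [a [v [vT ->]]]] /=.
rewrite Wf !linear_sum /=.
apply: eq_bigr => i _.
(* The intertwining relation passes to scalar multiples, which leaves only the generators
   [T^m y]. *)
have lin z : f (T z) = lam *: T (f z) ->
    f (T (a i *: z)) = lam *: T (f (a i *: z)).
  have TZ x : T (a i *: x) = a i *: T x by exact: linearZ_LR.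
  have fZ x : f (a i *: x) = a i *: f x by exact: linearZ_LR.
  by move=> fT; rewrite TZ !fZ TZ fT !scalerA mulrC.
apply: lin; have [m _ [y yk <-]] := vT i.
(* The formula at exponent [m] rewrites the right side; one more factor [lam T] makes the goal the
   formula at exponent [m.+1]. *)
rewrite -Wf (Wpow m _ yk).
exact: (Wpow m.+1).
Qed.
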